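(* Let $H$ be a separable complex Hilbert space and let $A$ and $B$ be two bounded linear operators on $H$ such that $A$ is normal and $AB$ is hyponormal. Then \[AA^*B=BAA^*\Longrightarrow BA \text{ is hyponormal.}\]
   Context: A bounded operator $T$ on $H$ is normal if $TT^*=T^*T$. It is hyponormal if $TT^*\leq T^*T$, equivalently $\|T^*x\|\leq\|Tx\|$ for all $x\in H$. *)

(* Defs.v *)
From HB Require Import structures.
From mathcomp Require Import all_boot all_order all_algebra complex.
From mathcomp Require Import all_classical all_reals all_analysis.

Set Implicit Arguments.
Unset Strict Implicit.
Unset Printing Implicit Defensive.

Import Order.TTheory GRing.Theory Num.Theory numFieldNormedType.Exports.

Local Open Scope classical_set_scope.
Local Open Scope ring_scope.
Local Open Scope complex_scope.

(* Complex Hilbert space: the inner product is linear in its first argument and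
   conjugate-linear in its second one. *)
HB.mixin Record isHilbert (R : realType) H & CompleteNormedModule R[i] H := {
  inner : {dot H for (@Num.conj R[i])};
  inner_norm : forall x : H, inner x x = `|x| ^+ 2
}.

#[short(type="hilbertType")]
HB.structure Definition Hilbert (R : realType) :=
  {H of CompleteNormedModule R[i] H & isHilbert R H}.

Definition separable (T : topologicalType) :=
  exists2 D : set T, countable D & dense D.

Section Operators.
Variables (R : realType) (H : hilbertType R).
Implicit Types S T : H -> H.

Definition bounded_operator T :=
  exists M : R, forall x, `|T x| <= M%:C * `|x|.

Lemma bounded_operatorP (T : {linear H -> H}) :
  bounded_operator T <-> continuous T.
Proof.
rewrite -linear_bounded_continuous linear_boundedP; split=> [[M TM]|].
  exists M%:C; split=> [|r Mr x]; first by rewrite complex_real.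
  by apply: le_trans (TM x) _; rewrite ler_wpM2r// ltW.
move=> /pinfty_ex_gt0[M M0 TM]; exists (complex.Re M) => x.
by rewrite RRe_real ?gtr0_real.
Qed.

(* The adjoint is the S such that <T x, y> = <x, S y>, which is unique, and
   exists when T is linear and bounded (Riesz representation); the default
   value 0 is irrelevant in that case. *)
Definition adjoint T : H -> H :=
  xget (fun=> 0) [set S | forall x y, inner (T x) y = inner x (S y)].

Lemma adjoint_unique T S :
  (forall x y, inner (T x) y = inner x (S y)) -> adjoint T = S.
Proof.
move=> TS; apply: xget_unique => // S' TS'; apply/funext => y; apply/eqP.
rewrite -subr_eq0; apply: contraT => /(neq0_dnorm_gt0 (s := inner)).
by rewrite linearB/= -TS' -TS subrr ltxx.
Qed.

(* In R[i], a <= b means that b - a is a nonnegative real number, so that this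
   says that T - S is a positive operator. *)
Definition operator_le S T :=
  forall x, inner (S x) x <= inner (T x) x.

Definition normal_operator T := T \o adjoint T = adjoint T \o T.

Definition hyponormal T := operator_le (T \o adjoint T) (adjoint T \o T).

End Operators.

(* Main.v *)
(** Let P = AA* = A*A, which commutes with A, A*, B and B*, and let c > 0 bound
    |A|^2. The operators e_0 = 1/c, e_(n+1) = e_n - P e_n^2 are polynomials in P
    with 0 <= e_n <= 1/c. They replace the polar decomposition of A: the sum of
    the P e_k^2 telescopes to 1/c - e_n, and e_n tends strongly to 0 on the range
    of A*.

    Put v = BAx, z = B*x, w = A*z. Hyponormality of AB at the vectors A e_n x
    gives <P e_n w, e_n w> <= <P e_n v, e_n v>, so that <e_n v, v> - <e_n w, w>
    is nonincreasing in n. If |v| < |w|, it starts at a negative value -d, hence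
    <e_n w, w> >= d for all n. But <e_n w, w>^2 = <A* e_n z, w>^2 is at most
    <P e_n z, e_n z> |w|^2, whose sum over n is at most |z|^2 |w|^2 / c, a
    contradiction.

    The adjoints exist by the Riesz representation theorem, obtained by
    minimizing |x|^2 - 2 f(x) over the underlying real Hilbert space. *)
From HB Require Import structures.
Require Import Defs.
From mathcomp Require Import all_boot all_order all_algebra complex.
From mathcomp Require Import all_classical all_reals all_analysis.
From mathcomp Require Import ring lra.
Import Order.TTheory GRing.Theory Num.Theory.
Import numFieldNormedType.Exports.
Local Open Scope classical_set_scope.
Local Open Scope ring_scope.
Local Open Scope complex_scope.

(** * The underlying real Hilbert space *)

Section RealInner.
Context {R : realType} {H : hilbertType R}.
Implicit Types (x y z : H) (a : R).

Definition rinner x y : R := complex.Re (inner x y).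
Definition sqnorm x : R := rinner x x.

Lemma rinnerDl x y z : rinner (x + y) z = rinner x z + rinner y z.
Proof. by rewrite /rinner linearDl raddfD. Qed.

Lemma rinnerC x y : rinner x y = rinner y x.
Proof.
by apply/complexI; rewrite !complexRe hermC expr0 mul1r Re_conj.
Qed.

Lemma rinnerZl a x y : rinner (a%:C *: x) y = a * rinner x y.
Proof.
rewrite /rinner linearZl_LR /=; case: (inner x y) => p q /=.
by rewrite mul0r subr0.
Qed.

Lemma rinnerNl x y : rinner (- x) y = - rinner x y.
Proof. by rewrite /rinner linearNl raddfN. Qed.

Lemma rinnerBl x y z : rinner (x - y) z = rinner x z - rinner y z.
Proof. by rewrite rinnerDl rinnerNl. Qed.

Lemma sqnormE x : (sqnorm x)%:C = `|x| ^+ 2.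
Proof. by rewrite -inner_norm RRe_real // ger0_real // inner_norm exprn_ge0. Qed.

Lemma sqnorm_ge0 x : 0 <= sqnorm x.
Proof. by rewrite -ler0c sqnormE exprn_ge0. Qed.

Lemma sqnormD x y : sqnorm (x + y) = sqnorm x + 2 * rinner x y + sqnorm y.
Proof.
rewrite /sqnorm rinnerDl ![rinner _ (x + y)]rinnerC !rinnerDl (rinnerC y x); lra.
Qed.

Lemma sqnormZ a x : sqnorm (a%:C *: x) = a ^+ 2 * sqnorm x.
Proof. by rewrite /sqnorm rinnerZl rinnerC rinnerZl mulrA expr2. Qed.

Lemma sqnormN x : sqnorm (- x) = sqnorm x.
Proof. by rewrite /sqnorm rinnerNl rinnerC rinnerNl opprK. Qed.

(** Sign of the discriminant; a = 0 is allowed, so that its uses need no case distinction on a zero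
    vector. *)
Lemma discriminant_le (a b c : R) : 0 <= a ->
  (forall t, 0 <= a * t ^+ 2 + 2 * b * t + c) -> b ^+ 2 <= a * c.
Proof.
move=> a0 h; pose s := [:: c; 2 * b; a].
have := @deg_le2_poly_delta_ge0 _ (Poly s) (size_Poly s).
rewrite !coef_Poly /= => /(_ a0) P.
suff : forall t, 0 <= (Poly s).[t] by move=> /P; lra.
by move=> t; have := h t; rewrite horner_Poly /=; lra.
Qed.

Lemma rinner_cauchy x y : rinner x y ^+ 2 <= sqnorm x * sqnorm y.
Proof.
rewrite mulrC; apply: discriminant_le; first exact: sqnorm_ge0.
move=> t; have := sqnorm_ge0 (x + t%:C *: y).
rewrite sqnormD sqnormZ [rinner x _]rinnerC rinnerZl [rinner y x]rinnerC; lra.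
Qed.

Lemma rinner_i x y : rinner ('i *: x) y = - complex.Im (inner x y).
Proof. by rewrite /rinner linearZl_LR mulrC /= ReiNIm. Qed.

(** Replacing x by 'i x turns real parts into imaginary parts, up to sign. *)
Lemma eq_rinner (T S : H -> H) : scalable T ->
  (forall x y, rinner (T x) y = rinner x (S y)) ->
  forall x y, inner (T x) y = inner x (S y).
Proof.
move=> TZ TS x y; apply/eqP; rewrite eq_complex; apply/andP; split.
  by apply/eqP/TS.
by rewrite -eqr_opp -!rinner_i -TZ TS.
Qed.

Lemma sqnorm_lt x (e : R) : 0 < e -> (sqnorm x < e ^+ 2) = (`|x| < e%:C).
Proof.
move=> e0; rewrite -ltcR sqnormE rmorphXn /= ltr_pXn2r // nnegrE //.
by rewrite ler0c ltW.
Qed.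

Lemma sqnorm_bounded (T : H -> H) (M : R) :
  (forall x, `|T x| <= M%:C * `|x|) ->
  forall x, sqnorm (T x) <= M ^+ 2 * sqnorm x.
Proof.
move=> TM x.
rewrite -lecR rmorphM rmorphXn /= !sqnormE -exprMn ler_pXn2r // nnegrE //.
exact: le_trans (TM x).
Qed.

(** * Riesz representation by minimization *)

Section Riesz.
Variables (f : H -> R) (K : R).
Hypotheses (fD : forall x y, f (x + y) = f x + f y)
  (fZ : forall a x, f (a%:C *: x) = a * f x)
  (fK : forall x, 2 * f x <= sqnorm x + K).

(** Boundedness of f enters only through [fK], which says that J is bounded below by -K. *)
Let J x := sqnorm x - 2 * f x.
Let m := inf (range J).

Let mP x : m <= J x.
Proof.
apply: ge_inf; last by exists x.
by exists (- K) => _ [y _ <-]; have := fK y; rewrite /J; lra.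
Qed.

Lemma riesz_minimizing_sequence :
  exists u : H ^nat, forall n, J (u n) < m + n.+1%:R^-1.
Proof.
suff /choice[u uJ] : forall n, exists x, J x < m + n.+1%:R^-1 by exists u.
move=> n; have [||_ [x _ <-]] := @inf_adherent _ (range J) n.+1%:R^-1.
- by rewrite invr_gt0.
- split; first by exists (J 0), 0.
  by exists (- K) => _ [y _ <-]; have := fK y; rewrite /J; lra.
by exists x.
Qed.

Lemma riesz_sqnormB x y : sqnorm (x - y) <= 2 * (J x + J y - 2 * m).
Proof.
(* The parallelogram identity, J at the midpoint being at least m. *)
have := mP ((2^-1)%:C *: (x + y)).
rewrite /J fZ fD sqnormZ !sqnormD sqnormN [rinner x (- y)]rinnerC rinnerNl.
rewrite [rinner y x]rinnerC; lra.
Qed.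

Lemma riesz : exists x, forall y, f y = rinner x y.
Proof.
have [u uJ] := riesz_minimizing_sequence.
have : cvg (u @ \oo).
  apply/cauchy_cvgP/cauchy_exP => e e0.
  have eE : e = (complex.Re e)%:C by rewrite RRe_real // gtr0_real.
  have re0 : 0 < complex.Re e by rewrite -(ltcR 0) -eE.
  (* When J x and J y are both below m + e^2/4, [riesz_sqnormB] gives |x - y|^2 < e^2. *)
  have d0 : 0 < complex.Re e ^+ 2 / 4 by rewrite divr_gt0 ?exprn_gt0.
  have [N _ NP] := near_infty_natSinv_lt (PosNum d0).
  exists (u N); exists N => // n /= Nn.
  rewrite -ball_normE /= eE -sqnorm_lt //.
  apply: le_lt_trans (riesz_sqnormB _ _) _.
  have := uJ N; have := uJ n.
  have /= := NP _ (leqnn N); have /= := NP _ Nn.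
  move: (n.+1%:R^-1) (N.+1%:R^-1) (complex.Re e ^+ 2) => a b s.
  lra.
move=> /cvg_ex [l /cvgrPdist_lt ul].
exists l => y; apply/eqP; rewrite -subr_eq0 -sqrf_eq0; apply/eqP/le_anti.
rewrite sqr_ge0 andbT; apply/ler_addgt0Pl => d d0; rewrite addr0.
(* The error <l,y> - f y splits at <u n,y>. Each half has square at most q |y|^2, so the whole has
   square at most 4 q |y|^2 <= d; the + 1 covers y = 0. *)
have q0 : 0 < d / (4 * (sqnorm y + 1)).
  by rewrite divr_gt0 // mulr_gt0 // ltr_wpDl // sqnorm_ge0.
set q := _ / _ in q0.
have sq0 : 0 < Num.sqrt q by rewrite sqrtr_gt0.
have [N _ NP] := near_infty_natSinv_lt (PosNum q0).
have [|N' _ NP'] := ul (Num.sqrt q)%:C; first by rewrite (ltcR 0).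
pose n := maxn N N'.
have /= := NP n (leq_maxl _ _).
have /= := NP' n (leq_maxr _ _); rewrite -sqnorm_lt // (sqr_sqrtr (ltW q0)) => h1.
move: (n.+1%:R^-1) (uJ n) => a uJn h2.
(* As u n minimizes J up to a, the quadratic J (u n + t y) - J (u n) + a in t is nonnegative. *)
have h3 : (rinner (u n) y - f y) ^+ 2 <= sqnorm y * a.
  apply: discriminant_le; first exact: sqnorm_ge0.
  move=> t; have := mP (u n + t%:C *: y); move: uJn.
  rewrite /J fD fZ sqnormD sqnormZ [rinner (u n) (_ *: _)]rinnerC rinnerZl.
  rewrite [rinner y _]rinnerC; lra.
have h4 := rinner_cauchy (l - u n) y; rewrite rinnerBl in h4.
have y0 := sqnorm_ge0 y.
have qE : q * (4 * (sqnorm y + 1)) = d by rewrite /q divfK // gt_eqF; lra.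
have : sqnorm y * a <= sqnorm y * q by rewrite ler_wpM2l // ltW.
have : sqnorm (l - u n) * sqnorm y <= q * sqnorm y by rewrite ler_wpM2r // ltW.
have : 0 <= (rinner l y - rinner (u n) y - (rinner (u n) y - f y)) ^+ 2.
  exact: sqr_ge0.
nra.
Qed.
End Riesz.

(** * Adjoints and hyponormality *)

Lemma rinner_inj x y : (forall z, rinner z x = rinner z y) -> x = y.
Proof.
move=> xy; apply/eqP; rewrite -subr_eq0 -normr_eq0 -sqrf_eq0 -sqnormE.
by rewrite /sqnorm rinnerBl (rinnerC x) (rinnerC y) xy subrr.
Qed.

Lemma adjointP (T : {linear H -> H}) : bounded_operator T ->
  exists2 S : {linear H -> H}, adjoint T = S &
    forall x y, inner (T x) y = inner x (S y).
Proof.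
move=> [M TM].
suff [S TS] : exists S : H -> H, forall x y, rinner (T x) y = rinner x (S y).
  have {}TS := eq_rinner _ _ (linearZZ T) TS.
  have Slin : linear S.
    move=> a x y; apply: rinner_inj => z.
    by rewrite /rinner -TS !linearDr !linearZr_LR /= !TS.
  pose SL : {linear H -> H} :=
    HB.pack S (GRing.isLinear.Build R[i] H H *:%R S Slin).
  by exists SL => //; exact: adjoint_unique.
suff /choice[S TS] : forall y, exists z, forall x, rinner (T x) y = rinner z x.
  by exists S => x y; rewrite TS rinnerC.
(* The constant comes from 2 <Tx,y> <= 2 |x| (M |y|) <= |x|^2 + M^2 |y|^2. *)
move=> y; apply: (riesz _ (M ^+ 2 * sqnorm y)) => [x z|a x|x].
- by rewrite linearD rinnerDl.
- by rewrite linearZZ rinnerZl.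
have := sqnorm_ge0 y; have := sqnorm_ge0 x; have := sqnorm_bounded T M TM x.
have := rinner_cauchy (T x) y.
move: (rinner (T x) y) (sqnorm (T x)) (sqnorm x) (sqnorm y) => r p q s h1 h2 h3 h4.
have h5 : r ^+ 2 <= q * (M ^+ 2 * s).
  by apply: le_trans h1 _; rewrite mulrCA mulrA ler_wpM2r.
have m0 : 0 <= M ^+ 2 * s by rewrite mulr_ge0 ?sqr_ge0.
move: (M ^+ 2 * s) m0 h5 => k k0 h5.
have := sqr_ge0 (q - k); nra.
Qed.

(** Both <TSx,x> = |Sx|^2 and <STx,x> = |Tx|^2 are real, so the order of [R[i]] reduces to that of
    [R]. *)
Lemma hyponormalP (T S : H -> H) :
  (forall x y, inner (T x) y = inner x (S y)) ->
  hyponormal T <-> forall x, sqnorm (S x) <= sqnorm (T x).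
Proof.
move=> TS; rewrite /hyponormal (adjoint_unique TS) /operator_le /=.
suff E x : (inner (T (S x)) x <= inner (S (T x)) x)
    = (sqnorm (S x) <= sqnorm (T x)) by split=> h x; rewrite ?E// -E.
rewrite -lecR !sqnormE -!inner_norm TS; congr (_ <= _).
have -> : inner (S (T x)) x = Num.conj (inner x (S (T x))).
  by rewrite hermC expr0 mul1r.
by rewrite -TS inner_norm; apply: geC0_conj; rewrite exprn_ge0.
Qed.

End RealInner.

(** * The polynomials e_n in a positive operator P with P^2 <= cP *)

Section Residuals.
Context {R : realType} {H : hilbertType R}.
Variables (P : {linear H -> H}) (c : R).
Hypotheses (c0 : 0 < c) (PC : forall x y, rinner (P x) y = rinner x (P y))
  (P0 : forall x, 0 <= rinner (P x) x)
  (Pc : forall x, sqnorm (P x) <= c * rinner (P x) x).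
Implicit Types (x y z : H) (n : nat).

(* [P \sum_(k < n) (resid k)^2 = c^-1 - resid n], whence the name. *)
Fixpoint resid n : {linear H -> H} :=
  if n is n'.+1 then resid n' \- (P \o (resid n' \o resid n'))
  else c^-1%:C \*: idfun.

Lemma resid0 x : resid 0 x = c^-1%:C *: x. Proof. by []. Qed.

Lemma residS n x : resid n.+1 x = resid n x - P (resid n (resid n x)).
Proof. by []. Qed.

Lemma resid_comm (T : {linear H -> H}) n :
  (forall x, T (P x) = P (T x)) -> forall x, T (resid n x) = resid n (T x).
Proof.
move=> TP; elim: n => [|n IH] x; first by rewrite !resid0 linearZZ.
by rewrite !residS linearB TP !IH.
Qed.

Lemma resid_sym n x y : rinner (resid n x) y = rinner x (resid n y).
Proof.
elim: n x y => [|n IH] x y.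
  by rewrite !resid0 rinnerZl [RHS]rinnerC rinnerZl rinnerC.
rewrite !residS rinnerBl IH PC !IH [RHS]rinnerC rinnerBl rinnerC.
by rewrite !(resid_comm P n) // [rinner x _]rinnerC.
Qed.

Lemma rinner_residS n x : rinner (resid n.+1 x) x =
  rinner (resid n x) x - rinner (P (resid n x)) (resid n x).
Proof.
by rewrite residS rinnerBl (resid_comm P n) // [X in _ - X]resid_sym.
Qed.

Lemma resid_le n x : rinner (resid n x) x <= c^-1 * sqnorm x.
Proof.
elim: n => [|n IH]; first by rewrite resid0 rinnerZl.
by rewrite rinner_residS; have := P0 (resid n x); lra.
Qed.

(** Write e_(n+1) = (1 - P e_n) e_n (1 - P e_n) + (P e_n^2 - P^2 e_n^3). The first term is positive
    by induction; the second because e_n <= 1/c and P^2 <= cP. *)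
Lemma resid_ge0 n x : 0 <= rinner (resid n x) x.
Proof.
elim: n x => [|n IH] x.
  by rewrite resid0 rinnerZl mulr_ge0 ?sqnorm_ge0// invr_ge0 ltW.
pose y := resid n x.
have h1 := IH (x - P y).
have h2 : rinner (resid n (P y)) (P y) <= rinner (P y) y.
  apply: le_trans (resid_le _ _) _.
  by rewrite ler_pdivrMl.
suff : rinner (resid n.+1 x) x = rinner (resid n (x - P y)) (x - P y) +
   (rinner (P y) y - rinner (resid n (P y)) (P y)) by lra.
rewrite rinner_residS -/y linearB -/y rinnerBl.
rewrite [rinner y (_ - _)]rinnerC [rinner (resid n _) (_ - _)]rinnerC !rinnerBl.
rewrite -[rinner x (resid n _)]resid_sym -/y [rinner y (P y)]rinnerC.
rewrite [rinner x y]rinnerC [rinner (P y) (resid _ _)]rinnerC; lra.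
Qed.

Lemma resid_sum_le n x :
  \sum_(k < n) rinner (P (resid k x)) (resid k x) <= c^-1 * sqnorm x.
Proof.
suff : \sum_(k < n) rinner (P (resid k x)) (resid k x) =
    rinner (resid 0 x) x - rinner (resid n x) x.
  by have := resid_ge0 n x; have := resid_le 0 x; lra.
elim: n => [|n IH]; first by rewrite big_ord0 subrr.
by rewrite big_ord_recr /= IH rinner_residS; lra.
Qed.

End Residuals.

(** * Exchanging the factors A and B *)

Section Main.
Context {R : realType} {H : hilbertType R}.
Variables (A A' B B' : {linear H -> H}) (c : R).
Hypotheses (AA' : forall x y, rinner (A x) y = rinner x (A' y))
  (BB' : forall x y, rinner (B x) y = rinner x (B' y))
  (Anormal : forall x, A (A' x) = A' (A x))
  (AA'B : forall x, A (A' (B x)) = B (A (A' x)))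
  (c0 : 0 < c) (Ac : forall x, sqnorm (A x) <= c * sqnorm x)
  (ABhypo : forall x, sqnorm (B' (A' x)) <= sqnorm (A (B x))).

Let P : {linear H -> H} := A \o A'.
Let e n := resid P c n.

Let A'A x y : rinner (A' x) y = rinner x (A y).
Proof. by rewrite rinnerC -AA' rinnerC. Qed.

Let PC x y : rinner (P x) y = rinner x (P y).
Proof. by rewrite /P /= AA' A'A. Qed.

Let P_sqnorm x : rinner (P x) x = sqnorm (A' x).
Proof. by rewrite /P /= AA'. Qed.

Let P_sqnormA x : rinner (P x) x = sqnorm (A x).
Proof. by rewrite /P /= Anormal A'A. Qed.

Let P0 x : 0 <= rinner (P x) x.
Proof. by rewrite P_sqnorm sqnorm_ge0. Qed.

Let Pc x : sqnorm (P x) <= c * rinner (P x) x.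
Proof. by rewrite P_sqnorm; exact: Ac. Qed.

Let AP x : A (P x) = P (A x).
Proof. by rewrite /P /= (Anormal x). Qed.

Let A'P x : A' (P x) = P (A' x).
Proof. by rewrite /P /= -Anormal. Qed.

Let BP x : B (P x) = P (B x).
Proof. by rewrite /P /= AA'B. Qed.

(** The adjoint of [BP], P being self-adjoint. *)
Let B'P x : B' (P x) = P (B' x).
Proof. by apply: rinner_inj => z; rewrite -BB' -PC -BP BB' PC. Qed.

Lemma hyponormal_swap x : sqnorm (A' (B' x)) <= sqnorm (B (A x)).
Proof.
rewrite leNgt; apply/negP => vw.
pose z := B' x; pose w := A' z; pose v := B (A x).
rewrite -/z -/w -/v in vw.
have d0 : 0 < c^-1 * (sqnorm w - sqnorm v).
  by rewrite mulr_gt0 ?invr_gt0 ?subr_gt0.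
set d := c^-1 * _ in d0.
have step n : rinner (P (e n w)) (e n w) <= rinner (P (e n v)) (e n v).
  rewrite /e /w /v /z -(resid_comm P c A') // -(resid_comm P c B') //.
  rewrite -(resid_comm P c B) // -(resid_comm P c A) // P_sqnorm P_sqnormA.
  set y := resid _ _ _ _.
  (* Here B'A'(Ay) = B'Py = PB'y = A(A'B'y), which by normality has the same norm as A'(A'B'y). *)
  apply: le_trans (ABhypo (A y)).
  by rewrite -Anormal -[A (A' y)]/(P y) B'P /= -P_sqnormA P_sqnorm.
have drift n : rinner (e n v) v - rinner (e n w) w <= - d.
  elim: n => [|n IH]; first by rewrite /e !resid0 !rinnerZl -/(sqnorm _) /d; lra.
  by rewrite /e !rinner_residS //; have := step n; rewrite /e in IH *; lra.
have dw n : d ^+ 2 <= rinner (P (e n z)) (e n z) * sqnorm w.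
  rewrite P_sqnorm; apply: le_trans (rinner_cauchy _ _).
  rewrite resid_comm // -/w.
  (* Since <e_n v,v> >= 0, the drift forces <e_n w,w> >= d > 0, which can be squared. *)
  have := resid_ge0 P c c0 PC P0 Pc n v; have := drift n; rewrite /e; nra.
have dn n : n%:R * d ^+ 2 <= c^-1 * sqnorm z * sqnorm w.
  apply: le_trans (ler_wpM2r (sqnorm_ge0 w) (resid_sum_le P c c0 PC P0 Pc n z)).
  rewrite mulr_suml mulr_natl -[n in leLHS]card_ord -sumr_const.
  by apply: ler_sum => k _; exact: dw.
have d20 : 0 < d ^+ 2 by rewrite exprn_gt0.
have := dn (Num.bound (c^-1 * sqnorm z * sqnorm w / d ^+ 2)).
rewrite leNgt -ltr_pdivrMr // archi_boundP //.
by rewrite divr_ge0 ?sqr_ge0 ?mulr_ge0 ?sqnorm_ge0 ?invr_ge0 ?(ltW c0).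
Qed.

End Main.

Theorem proposition2p1 (R : realType) (H : hilbertType R)
    (A B : {linear H -> H}) :
  separable H -> bounded_operator A -> bounded_operator B ->
  normal_operator A -> hyponormal (A \o B) ->
  (A \o adjoint A) \o B = B \o (A \o adjoint A) ->
  hyponormal (B \o A).
Proof.
move=> _ bA bB; rewrite /normal_operator.
have [A' -> AA'] := adjointP A bA.
have [B' _ BB'] := adjointP B bB.
move=> Anormal.
have -> : hyponormal (A \o B) <->
    forall x, sqnorm (B' (A' x)) <= sqnorm (A (B x)).
  by apply: hyponormalP => x y /=; rewrite AA' BB'.
move=> ABhypo AA'B.
apply/(hyponormalP _ (A' \o B')) => [x y|x] /=; first by rewrite BB' AA'.
have [M MA] := bA.
(* The + 1 keeps c positive even if M = 0. *)
apply: (hyponormal_swap A A' B B' (M ^+ 2 + 1)) => //.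
- by move=> *; rewrite /rinner AA'.
- by move=> *; rewrite /rinner BB'.
- by move=> y; exact: (congr1 (@^~ y) Anormal).
- by move=> y; exact: (congr1 (@^~ y) AA'B).
- by rewrite ltr_wpDl ?sqr_ge0.
move=> y; rewrite mulrDl mul1r; apply: ler_wpDr; first exact: sqnorm_ge0.
exact: sqnorm_bounded.
Qed.
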